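(* Let $R,S,T$ be operators on a Banach lattice $X$ such that $R\le S\le T\le Id_X+R$. If $R$ is a Dunford-Pettis operator and $T$ is a weakly demi Dunford-Pettis operator, then $S$ is a weakly demi Dunford-Pettis operator.
   Context: Operators are bounded and linear, and $Id_X$ is the identity operator of $X$. For operators $A,B$ on a Banach lattice $X$, $A\le B$ means that $(B-A)(x)\ge 0$ for every $x\ge 0$ in $X$. $X'$ and $X''$ denote the topological dual and bidual of $X$; weak convergence in $X$ is convergence in $\sigma(X,X')$ and weak convergence in $X'$ is convergence in $\sigma(X',X'')$. An operator $R\colon X\to X$ is Dunford-Pettis if $x_j\to 0$ weakly implies $\|R(x_j)\|\to 0$. An operator $T\colon X\to X$ is weakly demi Dunford-Pettis if for all sequences $(x_j)_{j=1}^{\infty}$ in $X$ and $(f_j)_{j=1}^{\infty}$ in $X'$ with $x_j\to 0$ weakly in $X$, $f_j\to 0$ weakly in $X'$ and $\|x_j-T(x_j)\|\to 0$, one has $|f_j(x_j)|\to 0$ as $j\to\infty$. *)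

(* Defs.v *)
From HB Require Import structures.
From mathcomp Require Import all_boot all_order all_algebra.
From mathcomp Require Import all_classical all_reals all_analysis.

Set Implicit Arguments.
Unset Strict Implicit.
Unset Printing Implicit Defensive.

Import Order.TTheory GRing.Theory Num.Theory.
Import numFieldNormedType.Exports.

Local Open Scope classical_set_scope.
Local Open Scope ring_scope.

(* The order is carried by the mixin rather than inherited from [Order.Lattice]:
   the hierarchy has no joins between the lattice structures and the normed
   ones, and they cannot be added downstream. *)
(* [`|x|] is the norm of [x]; its modulus is [bjoin x (- x)]. *)
HB.mixin Record isBanachLattice (K : realType) X of CompleteNormedModule K X := {
  ble : rel X ;
  bmeet : X -> X -> X ;
  bjoin : X -> X -> X ;
  ble_refl : reflexive ble ;
  ble_anti : antisymmetric ble ;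
  ble_trans : transitive ble ;
  ble_meet : forall x y z : X, ble z (bmeet x y) = ble z x && ble z y ;
  ble_join : forall x y z : X, ble (bjoin x y) z = ble x z && ble y z ;
  ble_addl : forall z x y : X, ble x y -> ble (z + x) (z + y) ;
  ble_scale : forall (a : K) (x y : X),
    0 <= a -> ble x y -> ble (a *: x) (a *: y) ;
  ble_norm : forall x y : X,
    ble (bjoin x (- x)) (bjoin y (- y)) -> `|x| <= `|y|
}.

#[short(type="banachLatticeType")]
HB.structure Definition BanachLattice (K : realType) :=
  { X of CompleteNormedModule K X & isBanachLattice K X }.

Section TopDual.
Variables (K : realType) (V : normedModType K).

Definition functional : {pred V -> K} :=
  [pred f : V -> K | `[< linear f /\ continuous f >] ].

Record topdual := Functional {
  functional_fun :> V -> K ;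
  functionalP : functional_fun \in functional
}.

HB.instance Definition _ := [isSub for functional_fun].
HB.instance Definition _ := [Choice of topdual by <:].

Lemma functional_submod_closed : submod_closed functional.
Proof.
have E f : (f \in functional) = `[< linear f /\ continuous f >] by [].
split=> [|a f g]; rewrite !E.
  apply/asboolP; split=> [b u v|]; last exact: cst_continuous.
  by rewrite /= scaler0 addr0.
move=> /asboolP[fl fc] /asboolP[gl gc]; apply/asboolP; split.
  move=> b u v; change (a * f (b *: u + v) + g (b *: u + v) =
    b * (a * f u + g u) + (a * f v + g v)).
  rewrite fl gl; change (a * (b * f u + f v) + (b * g u + g v) =
    b * (a * f u + g u) + (a * f v + g v)).
  by rewrite !mulrDr !mulrA (mulrC a b) addrACA.
move=> x; apply: continuousD; last exact: gc.
by apply: continuousZl_tmp; exact: fc.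
Qed.

HB.instance Definition _ :=
  GRing.isSubmodClosed.Build K (V -> K) functional functional_submod_closed.
HB.instance Definition _ := [SubChoice_isSubLmodule of topdual by <:].

Lemma topdual_linear (f : topdual) : linear f.
Proof. by have /asboolP[] := functionalP f. Qed.

Lemma topdual_continuous (f : topdual) : continuous f.
Proof. by have /asboolP[] := functionalP f. Qed.

HB.instance Definition _ (f : topdual) :=
  GRing.isLinear.Build K V K *:%R f (@topdual_linear f).

Lemma topdualDE (f g : topdual) x : (f + g) x = f x + g x.
Proof. by []. Qed.

Lemma topdualZE a (f : topdual) x : (a *: f) x = a * f x.
Proof. by []. Qed.

Definition topdual_norm (f : topdual) : K :=
  sup [set `|f x| | x in [set x : V | `|x| <= 1]].

Lemma topdual_norm_has_sup (f : topdual) :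
  has_sup [set `|f x| | x in [set x : V | `|x| <= 1]].
Proof.
split; first by exists `|f 0|, 0 => //=; rewrite normr0 ler01.
have /linear_bounded_continuous/bounded_funP/(_ 1)[M fM] := @topdual_continuous f.
by exists M => _ [x /= x1 <-]; exact: fM.
Qed.

Lemma topdual_norm_ub (f : topdual) x : `|x| <= 1 -> `|f x| <= topdual_norm f.
Proof.
move=> x1; apply: sup_upper_bound; first exact: topdual_norm_has_sup.
by exists x.
Qed.

Lemma topdual_norm_le (f : topdual) M :
  (forall x, `|x| <= 1 -> `|f x| <= M) -> topdual_norm f <= M.
Proof.
move=> fM; apply: ge_sup; first by case: (topdual_norm_has_sup f).
by move=> _ [x /= x1 <-]; exact: fM.
Qed.

Lemma ler_topdual_normD (f g : topdual) :
  topdual_norm (f + g) <= topdual_norm f + topdual_norm g.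
Proof.
apply: topdual_norm_le => x x1; rewrite topdualDE (le_trans (ler_normD _ _))//.
by rewrite lerD// topdual_norm_ub.
Qed.

Lemma topdual_normZ a (f : topdual) :
  topdual_norm (a *: f) = `|a| * topdual_norm f.
Proof.
apply/eqP; rewrite eq_le; apply/andP; split.
  apply: topdual_norm_le => x x1; rewrite topdualZE normrM.
  by rewrite ler_wpM2l// topdual_norm_ub.
have [->|a0] := eqVneq a 0.
  rewrite normr0 mul0r; apply: le_trans (@topdual_norm_ub (0 *: f) 0 _) => //.
  by rewrite normr0 ler01.
rewrite mulrC -ler_pdivlMr ?normr_gt0//; apply: topdual_norm_le => x x1.
rewrite ler_pdivlMr ?normr_gt0// mulrC -normrM -topdualZE.
exact: topdual_norm_ub.
Qed.

Lemma topdual_norm0_eq0 (f : topdual) : topdual_norm f = 0 -> f = 0.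
Proof.
move=> f0; apply/val_inj/funext => x /=.
have [->|x0] := eqVneq x 0; first by rewrite linear0.
have : `|f (`|x|^-1 *: x)| <= 0.
  rewrite -f0; apply: topdual_norm_ub.
  by rewrite normrZ normfV normr_id mulVf ?normr_eq0.
rewrite normr_le0 linearZ/= mulf_eq0 invr_eq0 normr_eq0 (negbTE x0)/=.
by move=> /eqP.
Qed.

HB.instance Definition _ := Lmodule_isNormed.Build K topdual
  ler_topdual_normD topdual_normZ topdual_norm0_eq0.

End TopDual.

(* sigma(V, V'): the coarsest topology making all of [topdual V] continuous. *)
Definition weak_topology (K : realType) (V : normedModType K) : Type := V.

HB.instance Definition _ (K : realType) (V : normedModType K) :=
  Topological.copy (weak_topology V) (sup_topology (fun f : topdual V =>
    Topological.class (initial_topology (f : V -> K)))).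

Definition weak_cvg (K : realType) (V : normedModType K) (x : V^nat) (l : V) :=
  (x : nat -> weak_topology V) @ \oo --> (l : weak_topology V).

Lemma weak_cvgP (K : realType) (V : normedModType K) (x : V^nat) (l : V) :
  weak_cvg x l <-> forall f : topdual V, f (x n) @[n --> \oo] --> f l.
Proof.
split=> [/cvg_sup xl f|xl].
  exact: (cvg_comp _ _ (xl f) (@initial_continuous _ _ (f : V -> K) l)).
apply/cvg_sup => f A [_ [[C Cop <-] Cfl] sCA].
have xC : \forall n \near \oo, C (f (x n)).
  by apply: (xl f C); exact: open_nbhs_nbhs.
change (\forall n \near \oo, A (x n)).
by apply: filterS xC => n Cn; exact: sCA.
Qed.

Section Operators.
Variables (K : realType) (X : banachLatticeType K).

Definition operator_le (A B : X -> X) :=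
  forall x : X, ble 0 x -> ble 0 (B x - A x).

Definition Dunford_Pettis (R : X -> X) :=
  forall x : X^nat, weak_cvg x 0 -> `|R (x j)| @[j --> \oo] --> (0 : K).

(* [weak_cvg f 0] is convergence in the topology of [topdual X] induced by
   [topdual (topdual X)], the bidual for the operator norm. *)
Definition weakly_demi_Dunford_Pettis (T : X -> X) :=
  forall (x : X^nat) (f : (topdual X)^nat),
    weak_cvg x 0 -> weak_cvg f 0 ->
    `|x j - T (x j)| @[j --> \oo] --> (0 : K) ->
    `|f j (x j)| @[j --> \oo] --> (0 : K).

End Operators.

(* Main.v *)
Require Import Defs.
From HB Require Import structures.
From mathcomp Require Import all_boot all_order all_algebra.
From mathcomp Require Import all_classical all_reals all_analysis.
Import Order.TTheory GRing.Theory Num.Theory.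
Import numFieldNormedType.Exports.
Local Open Scope classical_set_scope.
Local Open Scope ring_scope.

(** Put [C = Id - S + R] and [D = Id - T + R]. The hypotheses on [R], [S], [T]
    say that [0 <= D <= C <= Id]. An operator between [0] and [Id] belongs to
    the centre of the lattice, hence commutes with the modulus, so that
    [|D x| <= D |x| <= C |x| <= |C x|], and therefore [D x] is at most [C x] in
    norm (lemma [norm_le_central]). Up to the terms [R x_j], which tend to [0]
    in norm on a weakly null sequence because [R] is Dunford-Pettis, [C x_j] is
    [x_j - S x_j] and [D x_j] is [x_j - T x_j]. So every weakly null sequence
    almost fixed by [S] is almost fixed by [T], and the weak demi Dunford-Pettis
    property passes from [T] to [S]. *)

Section BanachLatticeOrder.
Variables (K : realType) (X : banachLatticeType K).
Implicit Types (x y z : X).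

Definition bmodulus x : X := bjoin x (- x).

Lemma ble_subr_ge0 x y : ble 0 (y - x) = ble x y.
Proof.
apply/idP/idP => /(ble_addl _ _ _) => [/(_ x)|/(_ (- x))].
  by rewrite addr0 addrC subrK.
by rewrite addNr addrC.
Qed.

Lemma ble_subl_addr x y z : ble (x - y) z = ble x (z + y).
Proof. by rewrite -ble_subr_ge0 opprB addrA ble_subr_ge0. Qed.

Lemma ble_modulus x : ble x (bmodulus x).
Proof. by have := ble_refl (bmodulus x); rewrite ble_join => /andP[]. Qed.

Lemma ble_oppr_modulus x : ble (- x) (bmodulus x).
Proof. by have := ble_refl (bmodulus x); rewrite ble_join => /andP[]. Qed.

Lemma modulusD_ge0 x : ble 0 (bmodulus x + x).
Proof. by rewrite -{2}(opprK x) ble_subr_ge0 ble_oppr_modulus. Qed.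

Lemma modulusB_ge0 x : ble 0 (bmodulus x - x).
Proof. by rewrite ble_subr_ge0 ble_modulus. Qed.

Lemma modulus_ge0 x : ble 0 (bmodulus x).
Proof.
have le2 : ble 0 (bmodulus x + bmodulus x).
  apply: (ble_trans _ _ _ (modulusD_ge0 x)).
  exact/ble_addl/ble_modulus.
have half_ge0 : 0 <= 2^-1 :> K by rewrite invr_ge0 ler0n.
have := ble_scale _ _ _ half_ge0 le2.
rewrite scaler0 -[bmodulus x]scale1r -scalerDl.
by rewrite scalerA mulVf ?pnatr_eq0// scale1r.
Qed.

(** [|x| + x] and [|x| - x] are twice the positive and negative parts of [x],
    whose infimum is [0]. *)
Lemma ble0_disjoint_parts x z :
  ble z (bmodulus x + x) -> ble z (bmodulus x - x) -> ble z 0.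
Proof.
move=> zD zB; have : ble (bmodulus x) (bmodulus x - z).
  rewrite {1}/bmodulus ble_join -!(ble_subr_ge0 _ (_ - z)) !(addrAC _ (- z)).
  by rewrite !ble_subr_ge0 opprK zB zD.
by rewrite -ble_subr_ge0 addrAC subrr ble_subr_ge0.
Qed.

End BanachLatticeOrder.

Arguments bmodulus {K X}.
Arguments modulus_ge0 {K X}.
Arguments modulusD_ge0 {K X}.
Arguments modulusB_ge0 {K X}.
Arguments ble0_disjoint_parts {K X}.

Section CentralOperators.
Variables (K : realType) (X : banachLatticeType K).
Implicit Types (C D : {linear X -> X}).

Lemma modulus_le_positive D (x : X) :
  operator_le (fun=> 0) D -> ble (bmodulus (D x)) (D (bmodulus x)).
Proof.
move=> D_ge0; have Dmono y z : ble y z -> ble (D y) (D z).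
  by rewrite -ble_subr_ge0 => /D_ge0; rewrite subr0 linearB ble_subr_ge0.
by rewrite ble_join -linearN !Dmono ?ble_modulus ?ble_oppr_modulus.
Qed.

(** Up to a factor [2], [C |x| - |C x|] is the infimum of [C] applied to the
    two parts of [x]; as [C <= Id], it lies below both parts themselves, which
    are disjoint. *)
Lemma central_le_modulus C (x : X) :
  operator_le C idfun -> ble (C (bmodulus x)) (bmodulus (C x)).
Proof.
move=> C_le1; rewrite -[bmodulus (C x)]add0r -ble_subl_addr.
have C_le y : ble 0 y -> ble (C y) y by move=> /C_le1; rewrite ble_subr_ge0.
apply: (ble0_disjoint_parts x).
  apply: (ble_trans _ _ _ _ (C_le _ (modulusD_ge0 x))).
  rewrite linearD; apply: ble_addl.
  by rewrite -[- _]add0r ble_subl_addr addrC modulusD_ge0.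
apply: (ble_trans _ _ _ _ (C_le _ (modulusB_ge0 x))).
rewrite linearB; apply: ble_addl.
by rewrite -[- bmodulus _]add0r ble_subl_addr addrC modulusB_ge0.
Qed.

Lemma norm_le_central C D (x : X) :
  operator_le (fun=> 0) D -> operator_le D C -> operator_le C idfun ->
  `|D x| <= `|C x|.
Proof.
move=> D_ge0 leDC C_le1; apply: ble_norm.
apply: (ble_trans _ _ _ (modulus_le_positive _ x D_ge0)).
apply: (ble_trans _ _ _ _ (central_le_modulus _ x C_le1)).
by rewrite -ble_subr_ge0; exact/leDC/modulus_ge0.
Qed.

End CentralOperators.

Theorem corollary3p3 (K : realType) (X : banachLatticeType K)
    (R S T : {linear X -> X})
    (R_bounded : bounded_near R (nbhs (0 : X)))
    (S_bounded : bounded_near S (nbhs (0 : X)))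
    (T_bounded : bounded_near T (nbhs (0 : X)))
    (leRS : operator_le R S)
    (leST : operator_le S T)
    (leTIR : operator_le T (fun x => x + R x))
    (R_DP : Dunford_Pettis R)
    (T_wdDP : weakly_demi_Dunford_Pettis T) :
  weakly_demi_Dunford_Pettis S.
Proof.
move=> x f x0 f0 xS; apply: T_wdDP => //.
pose C : {linear X -> X} := (idfun \- S) \+ R.
pose D : {linear X -> X} := (idfun \- T) \+ R.
have leDC y : `|D y| <= `|C y|.
  apply: norm_le_central => z z0 /=.
  - by rewrite subr0 addrAC; exact: leTIR.
  - rewrite opprD addrACA subrr addr0 opprB addrC addrA subrK.
    exact: leST.
  - by rewrite opprD opprB addrA (addrC z) subrK; exact: leRS.
have xT j : `|x j - T (x j)| <= `|x j - S (x j)| + (`|R (x j)| + `|R (x j)|).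
  have -> : x j - T (x j) = D (x j) - R (x j) by rewrite /D /= addrK.
  rewrite addrA (le_trans (ler_normB _ _))// lerD2r (le_trans (leDC _))//.
  exact: ler_normD.
have xR := R_DP x x0.
apply: (squeeze_cvgr (f := cst 0)
  (h := fun j => `|x j - S (x j)| + (`|R (x j)| + `|R (x j)|))).
- by near=> j; rewrite normr_ge0 xT.
- exact: cvg_cst.
- by rewrite -[0 in X in _ --> X]addr0 -[0 in X in _ --> _ + X]addr0;
    apply: cvgD => //; exact: cvgD.
Unshelve. all: by end_near.
Qed.
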